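(* (i) $\mathbb G_2$ is a $\mathbb C$-convex domain. (ii) For every $n\ge 3$, $\mathbb G_n$ is a linearly convex domain that is not $\mathbb C$-convex.
   Context: Let $\mathbb D$ be the open unit disc and $\sigma=(\sigma_1,\dots,\sigma_n):\mathbb C^n\to\mathbb C^n$, $\sigma_k(z_1,\dots,z_n)=\sum_{1\le j_1<\dots<j_k\le n}z_{j_1}\cdots z_{j_k}$. The symmetrized polydisc is $\mathbb G_n=\sigma(\mathbb D^n)$. A domain in $\mathbb C^n$ is $\mathbb C$-convex if each of its nonempty intersections with complex lines is connected and simply connected. It is linearly convex if each point in its complement belongs to a complex (affine) hyperplane disjoint from the domain. *)

(* Defs.v *)
From HB Require Import structures.
From mathcomp Require Import all_boot all_order all_algebra complex.
From mathcomp Require Import all_classical all_reals all_analysis.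
Import numFieldNormedType.Exports.
Import Order.TTheory GRing.Theory Num.Theory.

Set Implicit Arguments.
Unset Strict Implicit.
Unset Printing Implicit Defensive.

Local Open Scope classical_set_scope.
Local Open Scope ring_scope.

(* The library only puts the modulus topology on R[i] through its alias
   (R[i])^o; the copy makes it available on R[i] and hence on 'rV[R[i]]_n. *)
HB.instance Definition _ (R : realType) := NormedModule.copy R[i] (R[i])^o.

Section SimplyConnected.
Context (R : realType) (T : topologicalType).
Implicit Types (A : set T) (g : R -> T).

(* Paths are total functions of which only the values on [0, 1] matter. *)
Definition path_in A g :=
  {within `[0, 1], continuous g} /\ {in `[0, 1], forall t, A (g t)}.

Definition path_connected A :=
  forall x y, A x -> A y -> exists g, [/\ path_in A g, g 0 = x & g 1 = y].

(* Based homotopy H (s, t): s is the deformation parameter. *)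
Definition null_homotopic A g :=
  exists H : R * R -> T,
    [/\ {within `[0, 1] `*` `[0, 1], continuous H},
        {in `[0, 1] &, forall s t, A (H (s, t))},
        {in `[0, 1], forall t, H (0, t) = g t},
        {in `[0, 1], forall t, H (1, t) = g 0} &
        {in `[0, 1], forall s, H (s, 0) = g 0 /\ H (s, 1) = g 0}].

Definition simply_connected A :=
  path_connected A /\
  (forall g, path_in A g -> g 0 = g 1 -> null_homotopic A g).

End SimplyConnected.

Section ComplexConvexity.
Context (R : realType) (n : nat).
Implicit Types D L H : set 'rV[R[i]]_n.

Definition domain D := [/\ open D, connected D & D !=set0].

Definition complex_line L :=
  exists a v : 'rV[R[i]]_n,
    v != 0 /\ L = [set a + c *: v | c in [set: R[i]]].

Definition complex_hyperplane H :=
  exists (l : 'rV[R[i]]_n) (c : R[i]),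
    l != 0 /\ H = [set z | \sum_(j < n) l 0 j * z 0 j = c].

Definition C_convex D :=
  forall L, complex_line L -> D `&` L !=set0 ->
    connected (D `&` L) /\ simply_connected R (D `&` L).

Definition linearly_convex D :=
  forall z, ~ D z ->
    exists H, [/\ complex_hyperplane H, H z & H `&` D = set0].

(* Indices start at 0: the coordinate k carries the elementary symmetric
   polynomial of degree k.+1, with {j_1 < ... < j_(k+1)} encoded as a set. *)
Definition sigma (z : 'rV[R[i]]_n) : 'rV[R[i]]_n :=
  \row_(k < n) \sum_(J : {set 'I_n} | #|J| == k.+1) \prod_(j in J) z 0 j.

Definition polydisc : set 'rV[R[i]]_n := [set z | forall j, `|z 0 j| < 1].

Definition symmetrized_polydisc : set 'rV[R[i]]_n := sigma @` polydisc.

End ComplexConvexity.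

Arguments symmetrized_polydisc : clear implicits.

(* Main.v *)
Require Import Defs.
From mathcomp Require Import all_boot all_order all_algebra complex.
From mathcomp Require Import all_classical all_reals all_analysis.
From mathcomp Require Import zify ring lra.
Import numFieldNormedType.Exports.
Import Order.TTheory GRing.Theory Num.Theory.

(** Everything rests on one description of the symmetrized polydisc: with
    [root_poly s u = 1 - s_1 u + s_2 u^2 - ... + (-1)^n s_n u^n], which at
    [s = sigma z] factors as the product of the [1 - z_j u], a point [s] lies
    in G_n iff [root_poly s] has no zero in the closed unit disc
    ([symmetrized_polydiscP]).  Since [root_poly s u] is affine in [s], each
    zero [u] gives a hyperplane that avoids G_n, hence linear convexity.  On
    G_n the modulus of [root_poly s] is at least the product of the
    [1 - |z_j|], hence openness; and G_n is stable under
    [s_k |-> t^k s_k], hence connectedness.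

    For n >= 3, parametrize the complex line through the points
    [sigma (t, t, t, 0, ..., 0)] and [sigma (-t, -t, -t, 0, ..., 0)] of G_n, with
    t = 2/3, so that they have parameters 1 and -1.  The imaginary axis, which
    separates these parameters, avoids G_n: there [u |-> root_poly s (iu)] is a
    real cubic on the real line, equal to 1 at 0 and negative at 1 or at -1
    ([cubic_notin]).  So this section of G_n is disconnected.

    For n = 2, the positive real part of
    [(1 - zu)(1 - |x|^2) / ((1 - z x^* )(1 - xu))] for z, x in the disc and u in
    its closure ([Re_pick_gt0], a form of the Schwarz-Pick inequality) has two
    consequences.
    - A complex line that meets G_2 meets the royal variety
      [{sigma (x, x)}] inside G_2 ([complex_line_meets_royal]): otherwise both
      roots of the quadratic equation for x are of the form 1/u with |u| <= 1,
      and two numbers of positive real part would be opposite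
      ([apolar_disc_root]).
    - G_2 can be contracted to any royal point q along complex lines through
      q.  At q = 0 the contraction is the dilation [s |-> t s], which preserves
      G_2 because [t (1 - a)(1 - b) + (1 - t)] has no zero for a, b in the
      disc: a product of two numbers of positive real part is never a
      nonpositive real ([Re_gt0_mul_neq]).  The automorphisms of G_2 induced by
      the Moebius maps of the disc are projective, so they carry this
      contraction to every royal point and still respect lines;
      [royal_contraction] is the resulting formula.
    Hence each nonempty section of G_2 by a complex line is contractible, and
    a contractible set is connected and simply connected. *)

Set Implicit Arguments.
Unset Strict Implicit.
Unset Printing Implicit Defensive.

Local Open Scope classical_set_scope.
Local Open Scope ring_scope.

(** * Contractible sets are simply connected *)

Section Contractible.
Context (R : realType) (T : topologicalType).
Implicit Types (A : set T) (g : R -> T).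

(** The paths themselves are connected sets that share the point p. *)
Lemma connected_star A (p : T) : A p ->
  (forall y, A y -> exists2 g : R -> T, path_in A g & g 0 = y /\ g 1 = p) ->
  connected A.
Proof.
move=> Ap pathA.
have -> : A = \bigcup_(B in [set B | [/\ B p, B `<=` A & connected B]]) B.
  apply/seteqP; split=> [y Ay|y [B [_ BA _]] By]; last exact: BA.
  have [g [cg Ag] [g0 g1]] := pathA y Ay.
  exists (g @` `[0, 1]).
    split.
    - by exists 1 => //=; rewrite in_itv /= lexx ler01.
    - by move=> _ [t t01 <-]; exact: Ag.
    - exact: connected_continuous_connected (@segment_connected R 0 1) cg.
  by exists 0 => //=; rewrite in_itv /= lexx ler01.
by apply: bigcup_connected => [|B []//]; exists p => B [].
Qed.

Lemma within_continuous_if (X : topologicalType) (S : set X) (c : X -> R)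
    (f h : X -> T) :
  closed S -> continuous c ->
  {within S, continuous f} -> {within S, continuous h} ->
  (forall x, S x -> c x = 0 -> f x = h x) ->
  {within S, continuous (fun x => if c x <= 0 then f x else h x)}.
Proof.
move=> clS cc cf ch fh.
have cl (I : set R) : closed I -> closed (S `&` c @^-1` I).
  by move=> clI; apply: closedI => //; apply: preimage_closed.
have -> : S = (S `&` c @^-1` [set y | y <= 0]) `|`
              (S `&` c @^-1` [set y | 0 <= y]).
  rewrite -setIUr; apply/seteqP; split=> [x Sx|x []//]; split=> //=.
  by case/orP: (le_total (c x) 0); [left|right].
apply: withinU_continuous; [exact/cl/closed_le|exact/cl/closed_ge| |].
- apply: (subspace_eq_continuous (f := f)).
    by move=> x /set_mem [_ /= cx]; rewrite /from_subspace cx.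
  exact: continuous_subspaceW cf.
- apply: (subspace_eq_continuous (f := h)).
    move=> x /set_mem [Sx /= cx]; rewrite /from_subspace.
    case: ifPn => // cx0; apply/esym/fh => //.
    by apply/eqP; rewrite eq_le cx0.
  exact: continuous_subspaceW ch.
Qed.

Lemma continuous_minr (X : topologicalType) (f h : X -> R) :
  continuous f -> continuous h -> continuous (fun x => Num.min (f x) (h x)).
Proof.
move=> cf ch x; have := @continuous_min R X f h x.
by apply; [exact: cf|exact: ch].
Qed.

(** Composition with [clamp] turns a path on [0, 1] into a map that is continuous
    on the whole line. *)
Definition clamp (t : R) : R := Num.max 0 (Num.min t 1).

Lemma clamp_itv t : `[0, 1]%classic (clamp t).
Proof.
rewrite /= in_itv /= /clamp le_max lexx /= ge_max ler01 /=.
by rewrite ge_min lexx orbT.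
Qed.

Lemma clamp_le0 t : t <= 0 -> clamp t = 0.
Proof. by move=> t0; rewrite /clamp max_l // ge_min t0. Qed.

Lemma clamp_ge1 t : 1 <= t -> clamp t = 1.
Proof. by move=> t1; rewrite /clamp min_r // max_r. Qed.

Lemma clamp_id t : t \in `[0, 1] -> clamp t = t.
Proof. by rewrite in_itv /= => /andP[t0 t1]; rewrite /clamp min_l // max_r. Qed.

Lemma clamp_continuous : continuous clamp.
Proof.
move=> t.
have := @continuous_max R _ (fun=> 0) (fun t : R => Num.min t 1) t.
apply; first exact: cvg_cst.
by apply: (@continuous_min R _ id (fun=> 1) t); [exact: cvg_id|exact: cvg_cst].
Qed.

Lemma continuous_comp_clamp g :
  {within `[0, 1], continuous g} -> continuous (g \o clamp).
Proof.
move=> /subspace_continuousP cg t.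
move=> U /(cg _ (clamp_itv t)) /= /clamp_continuous; rewrite !nbhs_simpl /=.
by apply: filterS => s /= /(_ (clamp_itv s)).
Qed.

Context (A : set T) (p : T) (F : R * T -> T).
Context (Ap : A p) (F0 : forall y, A y -> F (0, y) = y)
  (F1 : forall y, A y -> F (1, y) = p)
  (FA : forall t y, t \in `[0, 1] -> A y -> A (F (t, y)))
  (cF : forall t y, t \in `[0, 1] -> A y -> {for (t, y), continuous F}).

Lemma continuous_contraction (X : topologicalType) (m : X -> R) (h : X -> T) :
  continuous m -> continuous h -> (forall x, A (h x)) ->
  continuous (fun x => F (clamp (m x), h x)).
Proof.
move=> cm ch Ah x.
have cmx : clamp (m y) @[y --> x] --> clamp (m x).
  by apply: continuous_comp; [exact: cm|exact: clamp_continuous].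
apply: cvg_trans (cF (clamp_itv (m x)) (Ah x)).
exact: (cvg_comp _ F (cvg_pair cmx (ch x))).
Qed.

Lemma contractible_connected : connected A.
Proof.
apply: (connected_star Ap) => y Ay; exists (fun t => F (clamp t, y)).
  split=> [|t _]; last by apply: FA => //; exact: clamp_itv.
  apply/continuous_subspaceT/continuous_contraction => // t.
    exact: cvg_id.
  exact: cvg_cst.
by rewrite clamp_le0 // clamp_ge1 // F0 // F1.
Qed.

Lemma contractible_path_connected : path_connected R A.
Proof.
move=> x y Ax Ay.
have cz (z : T) (c : R -> R) : continuous c -> A z ->
    {within `[0, 1], continuous (fun t => F (clamp (c t), z))}.
  move=> cc Az; apply/continuous_subspaceT/continuous_contraction => // t.
  exact: cvg_cst.
exists (fun t => if 2 * t - 1 <= 0 then F (clamp (2 * t), x)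
                 else F (clamp (2 - 2 * t), y)); split.
- split=> [|t t01]; last by case: ifP => _; apply: FA => //; exact: clamp_itv.
  have c2 : continuous (fun t : R => 2 * t).
    by move=> t; apply: cvgM; [exact: cvg_cst|exact: cvg_id].
  apply: within_continuous_if.
  + exact: interval_closed.
  + by move=> t; apply: cvgB; [exact: c2|exact: cvg_cst].
  + exact: cz.
  + by apply: cz => // t; apply: cvgB; [exact: cvg_cst|exact: c2].
  + by move=> t _ t2; rewrite !clamp_ge1 ?F1 //; lra.
- by rewrite ifT ?mulr0 ?clamp_le0 ?F0 //; lra.
- by rewrite ifF ?clamp_le0 ?F0 //; lra.
Qed.

(** The contraction F moves the base point, so F (s, g t) is only a free
    homotopy.  To repair this, for s in [0, 1/2] the loop is squeezed into the
    middle third of [0, 1] while F pushes it by time min (2 s) (tent t).  At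
    s = 1/2 what is left is t |-> F (tent t, g 0), a path followed to and fro:
    the middle third has been sent to p, and elsewhere the squeezed loop rests
    at g 0.  For s in [1/2, 1] this path is pulled back to g 0. *)
Lemma contractible_null_homotopic (g : R -> T) :
  path_in A g -> g 0 = g 1 -> null_homotopic A g.
Proof.
move=> [cg Ag] g01.
have in0 : 0 \in `[0 : R, 1] by rewrite in_itv /= lexx ler01.
(* G is constant outside [0, 1] because g is a loop. *)
pose G := g \o clamp.
have cG : continuous G by exact: continuous_comp_clamp.
have AG t : A (G t) by apply: Ag; exact: clamp_itv.
have G0 t : t <= 0 -> G t = g 0 by move=> t0; rewrite /G /= clamp_le0.
have G1 t : 1 <= t -> G t = g 0 by move=> t0; rewrite /G /= clamp_ge1.
pose tent (t : R) := Num.min (3 * t) (3 - 3 * t).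
pose H1 (z : R * R) :=
  F (clamp (Num.min (2 * z.1) (tent z.2)), G (z.2 + 2 * z.1 * (2 * z.2 - 1))).
pose H2 (z : R * R) := F (clamp (Num.min (2 - 2 * z.1) (tent z.2)), g 0).
have c1 : continuous (fun z : R * R => 2 * z.1).
  by move=> z; apply: cvgM; [exact: cvg_cst|exact: cvg_fst].
have c2 k : continuous (fun z : R * R => k * z.2).
  by move=> z; apply: cvgM; [exact: cvg_cst|exact: cvg_snd].
have ctent : continuous (fun z : R * R => tent z.2).
  apply: continuous_minr; first exact: c2.
  by move=> z; apply: cvgB; [exact: cvg_cst|exact: c2].
exists (fun z => if 2 * z.1 - 1 <= 0 then H1 z else H2 z); split.
- apply: within_continuous_if.
  + have -> : `[0, 1]%classic `*` `[0, 1]%classic =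
        fst @^-1` `[0, 1]%classic `&` snd @^-1` `[0 : R, 1]%classic by [].
    by apply: closedI; apply: preimage_closed; try exact: interval_closed;
      move=> z _; [exact: cvg_fst|exact: cvg_snd].
  + by move=> z; apply: cvgB; [exact: c1|exact: cvg_cst].
  + apply/continuous_subspaceT/continuous_contraction => //.
      exact: continuous_minr.
    move=> z; apply: (@cvg_comp _ _ _ _ G); last exact: cG.
    apply: cvgD; first exact: cvg_snd.
    apply: cvgM; first exact: c1.
    by apply: cvgB; [exact: c2|exact: cvg_cst].
  + apply/continuous_subspaceT/continuous_contraction => [|z|_].
    * apply: continuous_minr => // z.
      by apply: cvgB; [exact: cvg_cst|exact: c1].
    * exact: cvg_cst.
    * exact: Ag.
  + move=> [s t] /= _ s2; rewrite /H1 /H2 /=.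
    have -> : 2 - 2 * s = 2 * s by lra.
    have -> : t + 2 * s * (2 * t - 1) = 3 * t - 1.
      by rewrite (_ : 2 * s = 1); lra.
    have [t0|t0] := leP (3 * t) 1; first by rewrite G0 //; lra.
    have [t1|t1] := leP 2 (3 * t); first by rewrite G1 //; lra.
    by rewrite clamp_ge1 ?F1 //; [exact: Ag| rewrite /tent !le_min; lra].
- move=> s t s01 t01 /=.
  by case: ifP => _; (apply: FA; first exact: clamp_itv); [exact: AG|exact: Ag].
- move=> t t01 /=; rewrite ifT; last by lra.
  rewrite /H1 /= mulr0 mul0r addr0 clamp_le0 ?F0 //; last by rewrite ge_min lexx.
  by rewrite /G /= clamp_id.
- move=> t t01 /=; rewrite ifF; last by lra.
  by rewrite /H2 /= clamp_le0 ?F0 //; [exact: Ag|rewrite ge_min; lra].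
- move=> s; rewrite in_itv /= => s01.
  have tent0 : tent 0 <= 0 by rewrite /tent ge_min mulr0 lexx.
  have tent1 : tent 1 <= 0 by rewrite /tent ge_min; lra.
  have ag : A (g 0) by exact: Ag.
  have E t : tent t <= 0 -> G (t + 2 * s * (2 * t - 1)) = g 0 ->
      (if 2 * s - 1 <= 0 then H1 (s, t) else H2 (s, t)) = g 0.
    move=> t0 Gt; have c0 x : clamp (Num.min x (tent t)) = 0.
      by rewrite clamp_le0 // ge_min t0 orbT.
    by rewrite /H1 /H2 /= Gt !c0 F0 // if_same.
  split; apply: E => //; first by rewrite G0 //; lra.
  by rewrite G1 //; lra.
Qed.

Lemma contractible_simply_connected : simply_connected R A.
Proof.
split; [exact: contractible_path_connected|exact: contractible_null_homotopic].
Qed.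

End Contractible.

(** * Numbers of positive real part *)

Section PositiveRealPart.
Context (C : numClosedFieldType).
Implicit Types z w x u p q t : C.

Lemma Re_1B_gt0 w : `|w| < 1 -> 0 < 'Re (1 - w).
Proof.
move=> w1; rewrite raddfB /= (Creal_ReP 1 _) ?rpred1 // subr_gt0.
by apply: le_lt_trans w1; case: (leif_Re_Creal w).
Qed.

Lemma Re_gt0_neq0 w : 0 < 'Re w -> w != 0.
Proof. by apply: contraTneq => ->; rewrite raddf0 ltxx. Qed.

(** The arguments of p and q add up to a value in ]-pi, pi[.  Algebraically,
    p q = - t would give p |q|^2 = - t q^*, whose real parts have opposite
    signs. *)
Lemma Re_gt0_mul_neq p q t : 0 < 'Re p -> 0 < 'Re q -> 0 <= t -> p * q != - t.
Proof.
move=> p0 q0 t0; apply/negP => /eqP pq.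
have : p * `|q| ^+ 2 = - t * q^* by rewrite normCK mulrA pq.
move=> /(congr1 (fun z => 'Re z)).
rewrite ReMr ?rpredX ?normr_real // ReMl ?rpredN ?ger0_real // Re_conj.
apply/eqP; rewrite mulNr gt_eqF // (@le_lt_trans _ _ 0) //.
  by rewrite oppr_le0 mulr_ge0 // ltW.
by rewrite mulr_gt0 // exprn_gt0 // normr_gt0 Re_gt0_neq0.
Qed.

Lemma normC_1BM_sub z x : `|1 - z * x^*| ^+ 2 - `|z - x| ^+ 2 =
  (1 - `|x| ^+ 2) * (1 - `|z| ^+ 2).
Proof. by rewrite !normCK !rmorphB !rmorphM rmorph1 /= conjCK; ring. Qed.

Lemma onem_mul_neq0 z u : `|z| < 1 -> `|u| <= 1 -> 1 - z * u != 0.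
Proof.
move=> z1 u1; apply/Re_gt0_neq0/Re_1B_gt0.
by rewrite normrM (le_lt_trans _ z1) // ler_piMr.
Qed.

Lemma onem_sqr_norm_gt0 z : `|z| < 1 -> 0 < 1 - `|z| ^+ 2.
Proof. by move=> z1; rewrite subr_gt0 expr_lt1. Qed.

(** The quotient equals 1 - m(z) m'(u), where m(z) = (z - x) / (1 - z x^* ) and
    m'(u) = (u - x^* ) / (1 - x u) are Moebius maps that preserve the disc. *)
Lemma Re_pick_gt0 z x u : `|z| < 1 -> `|x| < 1 -> `|u| <= 1 ->
  0 < 'Re ((1 - z * u) * (1 - `|x| ^+ 2) / ((1 - z * x^*) * (1 - x * u))).
Proof.
move=> z1 x1 u1.
have zx0 : 1 - z * x^* != 0 by rewrite onem_mul_neq0 // norm_conjC ltW.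
have xu0 : 1 - x * u != 0 by rewrite onem_mul_neq0.
have -> : (1 - z * u) * (1 - `|x| ^+ 2) / ((1 - z * x^*) * (1 - x * u)) =
    1 - (z - x) / (1 - z * x^*) * ((u - x^*) / (1 - x * u)).
  by rewrite normCK; field; apply/andP.
apply: Re_1B_gt0; rewrite normrM.
have lt1 : `|(z - x) / (1 - z * x^*)| < 1.
  rewrite normf_div ltr_pdivrMr ?normr_gt0 // mul1r.
  rewrite -(@ltr_pXn2r _ 2) ?nnegrE // -subr_gt0 normC_1BM_sub.
  by rewrite mulr_gt0 ?onem_sqr_norm_gt0.
apply: le_lt_trans lt1; rewrite ler_piMr //.
rewrite normf_div ler_pdivrMr ?normr_gt0 // mul1r.
rewrite -(@ler_pXn2r _ 2) ?nnegrE // -subr_ge0.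
rewrite (_ : x * u = u * x^*^*); last by rewrite conjCK mulrC.
by rewrite normC_1BM_sub norm_conjC mulr_ge0 // subr_ge0 expr_le1 // ltW.
Qed.

(** The Grace-Walsh-Szego coincidence theorem in degree 2: if the polarisation
    at (z1, z2) of the quadratic polynomial with roots 1 / u1 and 1 / u2
    vanishes, these roots cannot both lie outside the disc.  Up to a nonzero
    factor the left-hand side is the sum of the quotients of
    [Re_pick_gt0] with x = z1, z = z2, u = u1 and u = u2. *)
Lemma apolar_disc_root z1 z2 u1 u2 : `|z1| < 1 -> `|z2| < 1 ->
  `|u1| <= 1 -> `|u2| <= 1 ->
  (1 - z1 * u1) * (1 - z2 * u2) + (1 - z1 * u2) * (1 - z2 * u1) != 0.
Proof.
move=> z1D z2D u1D u2D.
have r1 := Re_pick_gt0 z2D z1D u1D; have r2 := Re_pick_gt0 z2D z1D u2D.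
have : 0 < 'Re
    ((1 - z2 * u1) * (1 - `|z1| ^+ 2) / ((1 - z2 * z1^*) * (1 - z1 * u1)) +
     (1 - z2 * u2) * (1 - `|z1| ^+ 2) / ((1 - z2 * z1^*) * (1 - z1 * u2))).
  by rewrite raddfD addr_gt0.
move=> /Re_gt0_neq0; apply: contra_neq => e.
have a0 : 1 - z2 * z1^* != 0 by rewrite onem_mul_neq0 // norm_conjC ltW.
have b0 : 1 - z1 * u1 != 0 by rewrite onem_mul_neq0.
have c0 : 1 - z1 * u2 != 0 by rewrite onem_mul_neq0.
transitivity ((1 - `|z1| ^+ 2) / (1 - z2 * z1^*) / (1 - z1 * u1)
    / (1 - z1 * u2) *
  ((1 - z1 * u1) * (1 - z2 * u2) + (1 - z1 * u2) * (1 - z2 * u1))).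
  by field; apply/and3P.
by rewrite e mulr0.
Qed.

(** Starlikeness of the symmetrized bidisc with respect to the image of (x, x),
    in terms of roots.  Dividing by the second term without its factor 1 - t
    gives t p1 p2 + (1 - t), where p1 and p2 are as in [Re_pick_gt0]. *)
Lemma starlike_pencil_neq0 z1 z2 x u t :
  `|z1| < 1 -> `|z2| < 1 -> `|x| < 1 -> `|u| <= 1 -> 0 <= t <= 1 ->
  t * ((1 - z1 * u) * (1 - z2 * u)) + (1 - t) *
    ((1 - z1 * x^*) * (1 - z2 * x^*) / (1 - `|x| ^+ 2) ^+ 2) * (1 - x * u) ^+ 2
  != 0.
Proof.
move=> z1D z2D xD uD /andP[t0 t1].
have a0 : 1 - z1 * x^* != 0 by rewrite onem_mul_neq0 // norm_conjC ltW.
have b0 : 1 - z2 * x^* != 0 by rewrite onem_mul_neq0 // norm_conjC ltW.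
have c0 : 1 - x * u != 0 by rewrite onem_mul_neq0.
have d0 : 1 - `|x| ^+ 2 != 0 by rewrite gt_eqF ?onem_sqr_norm_gt0.
set d := (1 - z1 * x^*) * (1 - z2 * x^*) / (1 - `|x| ^+ 2) ^+ 2.
have dn0 : d * (1 - x * u) ^+ 2 != 0.
  by rewrite !mulf_neq0 ?invr_eq0 ?expf_neq0.
set p1 := (1 - z1 * u) * (1 - `|x| ^+ 2) / ((1 - z1 * x^*) * (1 - x * u)).
set p2 := (1 - z2 * u) * (1 - `|x| ^+ 2) / ((1 - z2 * x^*) * (1 - x * u)).
have -> : t * ((1 - z1 * u) * (1 - z2 * u)) + (1 - t) * d * (1 - x * u) ^+ 2 =
    (t * (p1 * p2) + (1 - t)) * (d * (1 - x * u) ^+ 2).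
  by rewrite /p1 /p2 /d; field; apply/and4P.
rewrite mulf_neq0 //.
have [-> | tn0] := eqVneq t 0; first by rewrite mul0r subr0 add0r oner_neq0.
have : p1 * p2 != - ((1 - t) / t).
  by rewrite Re_gt0_mul_neq ?Re_pick_gt0 // divr_ge0 ?subr_ge0.
apply: contra_neq => /eqP; rewrite addr_eq0 => /eqP e.
by apply: (mulfI tn0); rewrite e mulrN mulrCA mulfV // mulr1.
Qed.

End PositiveRealPart.

(** * The symmetrized polydisc as a set of zero-free polynomials *)

Lemma coef_prod_XsubC_sigma (R : realType) (r : seq R[i]) n (k : 'I_n) :
  size r = n -> (\prod_(x <- r) ('X - x%:P))`_(n - k.+1) =
    (-1) ^+ k.+1 * sigma (\row_(j < n) r`_j) 0 k.
Proof.
move=> szr; case: n / szr k => k; rewrite coef_prod_XsubC ?leq_subr // subKn //.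
congr (_ * _); rewrite mxE; apply: eq_bigr => J _.
by apply: eq_bigr => j _; rewrite mxE.
Qed.

Section SymmetrizedPolydisc.
Context (R : realType) (n : nat).
Implicit Types (z s : 'rV[R[i]]_n) (u : R[i]).

Definition root_poly s u : R[i] :=
  1 + \sum_(k < n) (- u) ^+ k.+1 * s 0 k.

Lemma root_poly_sigma z u :
  root_poly (sigma z) u = \prod_(j < n) (1 - z 0 j * u).
Proof.
transitivity (\prod_(j < n) (- (z 0 j * u) + 1)); last first.
  by apply: eq_bigr => j _; rewrite addrC.
rewrite bigA_distr.
have cardlt (J : {set 'I_n}) : (#|J| < n.+1)%N.
  by rewrite ltnS (leq_trans (max_card _)) ?card_ord.
rewrite (partition_big (fun J : {set 'I_n} => Ordinal (cardlt J)) xpredT) //=.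
rewrite big_ord_recl /root_poly; congr (_ + _).
  rewrite (big_pred1 (@finset.set0 'I_n)).
    by rewrite big1 // => j _; rewrite inE.
  by move=> J; rewrite /= -val_eqE /= cards_eq0.
apply: eq_bigr => k _; rewrite mxE mulr_sumr.
apply: eq_big => [J|J /eqP Jk]; first by rewrite -val_eqE /=.
rewrite -big_mkcond /= -Jk -prodr_const -big_split /=.
by apply: eq_bigr => j _; rewrite mulNr mulrC.
Qed.

(** Reversing a zero-free [root_poly s] gives u^n root_poly s (1 / u), a monic
    polynomial of degree n; its n roots lie in the open disc, and s consists of
    their elementary symmetric functions. *)
Lemma symmetrized_polydiscP s :
  symmetrized_polydisc R n s <-> forall u, `|u| <= 1 -> root_poly s u != 0.
Proof.
split=> [[z zD <-] u uD | s0].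
  by rewrite root_poly_sigma; apply/prodf_neq0 => j _; exact: onem_mul_neq0.
pose q : {poly R[i]} := \sum_(k < n) ((-1) ^+ k.+1 * s 0 k) *: 'X^(n - k.+1).
have szq : (size q <= n)%N.
  apply: (leq_trans (size_sum _ _ _)); apply/bigmax_leqP => k _.
  rewrite (leq_trans (size_scale_leq _ _)) // size_polyXn -subSn //.
  by rewrite subSS leq_subr.
pose p := 'X^n + q.
have szp : size p = n.+1 by rewrite size_polyDl size_polyXn.
have lcp : lead_coef p = 1 by rewrite lead_coefDl ?size_polyXn // lead_coefXn.
have pE u : u != 0 -> p.[u^-1] = u^-1 ^+ n * root_poly s u.
  move=> u0; rewrite /p /root_poly hornerD hornerXn horner_sum.
  rewrite mulrDr mulr1 mulr_sumr.
  congr (_ + _); apply: eq_bigr => k _; rewrite hornerZ hornerXn.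
  have -> : u^-1 ^+ n = u^-1 ^+ (n - k.+1) * u^-1 ^+ k.+1.
    by rewrite -exprD subnK.
  have e : u^-1 ^+ k.+1 * u ^+ k.+1 = 1 by rewrite -exprMn mulVf // expr1n.
  rewrite [(- u) ^+ _]exprNn.
  move: (u^-1 ^+ (n - k.+1)) (u^-1 ^+ k.+1) (u ^+ k.+1) e.
  move: ((-1 : R[i]) ^+ k.+1).
  by move=> a b c d e; rewrite -[LHS]mulr1 -e; ring.
have [r rE] := closed_field_poly_normal p.
rewrite lcp scale1r in rE.
have szr : size r = n by have := szp; rewrite rE size_prod_XsubC => -[].
have rD x : x \in r -> `|x| < 1.
  move=> xr; rewrite real_ltNge ?normr_real ?real1 //; apply/negP => x1.
  have x0 : x != 0 by rewrite -normr_gt0 (lt_le_trans ltr01).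
  have /s0 : `|x^-1| <= 1 by rewrite normfV invf_le1 ?normr_gt0.
  have := pE x^-1; rewrite invr_eq0 invrK => /(_ x0) px.
  have : root p x by rewrite rE root_prod_XsubC.
  rewrite rootE px mulf_eq0 expf_eq0 (negPf x0) andbF /= => /eqP->.
  by rewrite eqxx.
exists (\row_j r`_j) => [j|]; first by rewrite /= mxE rD // mem_nth // szr.
apply/rowP => k.
have pk : p`_(n - k.+1) = (-1) ^+ k.+1 * s 0 k.
  rewrite coefD coefXn coef_sum (bigD1 k) //= big1 => [|l lk].
    rewrite coefZ coefXn eqxx mulr1 addr0 ltn_eqF ?add0r //.
    by rewrite ltn_subrL /= (leq_trans _ (ltn_ord k)).
  rewrite coefZ coefXn; case: eqP => [e|_]; rewrite ?mulr0 //.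
  by case/eqP: lk; apply/val_inj => /=; move: (ltn_ord k) (ltn_ord l); lia.
apply: (@mulfI _ ((-1) ^+ k.+1)); first by rewrite signr_eq0.
by rewrite -pk rE coef_prod_XsubC_sigma.
Qed.

Lemma symmetrized_polydisc0 : symmetrized_polydisc R n 0.
Proof.
apply/symmetrized_polydiscP => u _.
rewrite /root_poly big1 ?addr0 ?oner_neq0 //.
by move=> k _; rewrite mxE mulr0.
Qed.

(** If s = sigma z, then |root_poly s| >= e := \prod_j (1 - |z_j|) on the closed
    disc, where root_poly changes by less than e on the ball of radius
    e / (n + 1) around s. *)
Lemma open_symmetrized_polydisc : open (symmetrized_polydisc R n).
Proof.
rewrite openE => s [z zD sz].
pose e : R[i] := \prod_(j < n) (1 - `|z 0 j|).
have e0 : 0 < e by apply: prodr_gt0 => j _; rewrite subr_gt0 zD.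
pose d := e / n.+1%:R; have d0 : 0 < d by rewrite divr_gt0 // ltr0n.
apply/nbhs_ballP; exists d => //= s' [_ s'B].
apply/symmetrized_polydiscP => u uD.
have : e <= `|root_poly s u|.
  rewrite -sz root_poly_sigma normr_prod; apply: ler_prod => j _.
  rewrite subr_ge0 ltW ?zD //=.
  rewrite (le_trans _ (lerB_dist _ _)) // normr1 lerD2l lerN2 normrM.
  by rewrite ler_piMr.
apply: contraTneq => su; rewrite -real_ltNge ?normr_real ?gtr0_real //.
have -> : root_poly s u = \sum_(k < n) (- u) ^+ k.+1 * (s 0 k - s' 0 k).
  rewrite -[LHS]subr0 -[X in _ - X = _]su /root_poly opprD addrACA subrr add0r.
  rewrite -sumrB.
  by apply: eq_bigr => k _; rewrite mulrBr.
apply: (@le_lt_trans _ _ (\sum_(k < n) d)).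
  apply: (le_trans (ler_norm_sum _ _ _)); apply: ler_sum => k _.
  rewrite normrM normrX normrN (@le_trans _ _ `|s 0 k - s' 0 k|) //.
    by rewrite ler_piMl // exprn_ile1.
  by apply/ltW; have := s'B 0 k; rewrite -ball_normE.
rewrite sumr_const card_ord -mulr_natr /d -mulrA gtr_pMr //.
by rewrite mulrC ltr_pdivrMr ?ltr0n // mul1r ltr_nat.
Qed.

(** For a zero u of [root_poly s] in the closed disc, the equation
    root_poly s' u = 0 defines a hyperplane in s': its linear part is nonzero
    because the constant term 1 is. *)
Lemma linearly_convex_symmetrized_polydisc :
  linearly_convex (symmetrized_polydisc R n).
Proof.
move=> s sG.
have [u uD su] : exists2 u, `|u| <= 1 & root_poly s u = 0.
  apply: contrapT => nu; apply/sG/symmetrized_polydiscP => u uD.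
  by apply/eqP => su; apply: nu; exists u.
exists [set s' | root_poly s' u = 0]; split => //.
- exists (\row_k (- u) ^+ k.+1), (-1); split.
    apply: contraTneq (oner_neq0 R[i]) => l0; rewrite negbK -su /root_poly.
    rewrite big1 ?addr0 // => k _.
    by have /rowP/(_ k) := l0; rewrite !mxE => ->; rewrite mul0r.
  have lE s' : \sum_(k < n) (\row_k (- u) ^+ k.+1) 0 k * s' 0 k =
      root_poly s' u - 1.
    rewrite /root_poly addrAC subrr add0r.
    by apply: eq_bigr => k _; rewrite mxE.
  apply/seteqP; split=> s' /=; rewrite lE; first by move=> ->; rewrite sub0r.
  by move=> /eqP; rewrite subr_eq addrC subrr => /eqP.
- apply/seteqP; split=> s' //= -[s'u].
  by move=> /symmetrized_polydiscP /(_ u uD); rewrite s'u eqxx.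
Qed.

Lemma symmetrized_polydisc_dilate (s : 'rV[R[i]]_n) (t : R[i]) :
  `|t| <= 1 -> symmetrized_polydisc R n s ->
  symmetrized_polydisc R n (\row_k (t ^+ k.+1 * s 0 k)).
Proof.
move=> t1 /symmetrized_polydiscP sG; apply/symmetrized_polydiscP => u uD.
have := sG (t * u); rewrite normrM mulr_ile1 // => /(_ isT).
congr (_ != _); rewrite /root_poly; congr (_ + _); apply: eq_bigr => k _.
by rewrite mxE -mulrN exprMn mulrCA mulrA.
Qed.

End SymmetrizedPolydisc.

(** * Continuity, and the symmetrized polydisc is a domain *)

Section ComplexTopology.
Context (R : realType).

Lemma real_complex_continuous : continuous (fun t : R => t%:C%C).
Proof.
move=> t; apply/cvgrPdist_lt => e e0.
have [e1 e2] : e = (complex.Re e)%:C%C /\ 0 < complex.Re e.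
  have er : e \is Num.real by apply: gtr0_real.
  by split; [rewrite RRe_real|rewrite -ltcR RRe_real].
near=> u.
rewrite e1 -rmorphB /= normc_def /= expr0n addr0 sqrtr_sqr ltcR.
near: u; exact: cvgr_dist_lt.
Unshelve. all: by end_near. Qed.

Lemma Re_continuous : continuous (@complex.Re R).
Proof.
move=> z U /nbhs_ballP [e e0 eU].
have e0C : 0 < e%:C%C by rewrite ltcR.
have : nbhs z (ball z e%:C%C) by exact: nbhsx_ballx.
apply: filterS => w; rewrite -ball_normE /= => zw.
apply: eU; rewrite -ball_normE /= -ltcR (le_lt_trans _ zw) //.
case: z w {zw} => [a b] [c d] /=.
exact: (normc_ge_Re ((a +i* b) - (c +i* d))%C).
Qed.

Lemma row_continuous (X : topologicalType) n (f : X -> 'rV[R[i]]_n) :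
  (forall k, continuous (fun x => f x 0 k)) -> continuous f.
Proof.
move=> cf x U [P PU sPU].
have : nbhs x (fun y => forall k, P 0 k (f y 0 k)).
  by apply: filter_forall => k; apply: cf; exact: PU.
by apply: filterS => y Py; apply: sPU => i j; rewrite (ord1 i).
Qed.

(** The weighted dilations s_k |-> (1 - t)^k s_k join each point to 0. *)
Lemma domain_symmetrized_polydisc n : domain (symmetrized_polydisc R n).
Proof.
split; first exact: open_symmetrized_polydisc; last first.
  by exists 0; exact: symmetrized_polydisc0.
apply: (@connected_star R 'rV[R[i]]_n (symmetrized_polydisc R n) 0).
  exact: symmetrized_polydisc0.
move=> s sG; exists (fun t : R => \row_k ((1 - t)%:C%C ^+ k.+1 * s 0 k)).
  split=> [|t t01].
    apply/continuous_subspaceT/row_continuous => k t.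
    rewrite (_ : (fun r => _) = fun r => ((1 - r) ^+ k.+1)%:C%C * s 0 k);
      last first.
      by apply/funext => r; rewrite mxE -rmorphXn.
    have c1 : continuous (fun r : R => 1 - r).
      by move=> r; apply: cvgB; [exact: cvg_cst|exact: cvg_id].
    apply: cvgM; last exact: cvg_cst.
    exact: (cvg_comp _ _ (cvg_comp _ _ (c1 t) (@exprn_continuous R k.+1 _))
              (@real_complex_continuous _)).
  apply: symmetrized_polydisc_dilate => //.
  rewrite normc_def /= expr0n addr0 sqrtr_sqr lecR ler_norml.
  by move: t01; rewrite in_itv /=; lra.
split; apply/rowP => k; rewrite !mxE ?subr0 ?rmorph1 ?expr1n ?mul1r //.
by rewrite subrr rmorph0 expr0n mul0r.
Qed.

End ComplexTopology.

(** * Complex sections of the symmetrized bidisc *)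

(** Lets the rules for limits apply to functions of a complex matrix. *)
#[local] Instance matrix_nbhs_filter (R : realType) m n (s : 'M[R[i]]_(m, n)) :
  Filter (nbhs s).
Proof. exact: nbhs_filter. Qed.

Section RootPolyAffine.
Context (R : realType) (n : nat).
Implicit Types (s r : 'rV[R[i]]_n) (u c : R[i]).

Lemma root_poly_affine s r c u : root_poly (s + c *: (r - s)) u =
  (1 - c) * root_poly s u + c * root_poly r u.
Proof.
rewrite /root_poly !mulrDr !mulr1 addrACA subrK; congr (_ + _).
rewrite !mulr_sumr -big_split /=; apply: eq_bigr => k _; rewrite !mxE; ring.
Qed.

End RootPolyAffine.

Lemma ord2 (k : 'I_2) : k = 0 \/ k = 1.
Proof. by case: k => -[|[|//]] ?; [left|right]; exact: val_inj. Qed.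

Section SymmetrizedBidisc.
Context (R : realType).
Implicit Types (s v : 'rV[R[i]]_2) (x u : R[i]).
Local Notation G2 := (symmetrized_polydisc R 2).

Lemma root_poly2 s u : root_poly s u = 1 - s 0 0 * u + s 0 1 * u ^+ 2.
Proof.
rewrite /root_poly !big_ord_recl big_ord0 /=.
have -> : s 0 (lift ord0 ord0) = s 0 1 by congr (s _ _); exact: val_inj.
by rewrite -[s 0 ord0]/(s 0 0); ring.
Qed.

Lemma root_poly2_continuous u : continuous (fun s => root_poly s u).
Proof.
rewrite (_ : (fun s => _) = fun s => 1 - s 0 0 * u + s 0 1 * u ^+ 2);
  last first.
  by apply/funext => s; exact: root_poly2.
move=> s; apply: cvgD.
  apply: cvgB; first exact: cvg_cst.
  by apply: cvgM; [exact: coord_continuous|exact: cvg_cst].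
by apply: cvgM; [exact: coord_continuous|exact: cvg_cst].
Qed.

Lemma root_poly2_inj s x y :
  (forall u, root_poly s u = 1 - x * u + y * u ^+ 2) -> s 0 0 = x /\ s 0 1 = y.
Proof.
move=> sE; have n2 : (2 : R[i]) != 0 by rewrite pnatr_eq0.
split; apply: (mulfI n2).
  transitivity (root_poly s (-1) - root_poly s 1).
    by rewrite !root_poly2; ring.
  by rewrite !sE; ring.
transitivity (root_poly s (-1) + root_poly s 1 - 2).
  by rewrite !root_poly2; ring.
by rewrite !sE; ring.
Qed.

Lemma symmetrized_bidisc_factor s : G2 s ->
  exists z1 z2, [/\ `|z1| < 1, `|z2| < 1, s 0 0 = z1 + z2, s 0 1 = z1 * z2 &
  forall u, root_poly s u = (1 - z1 * u) * (1 - z2 * u)].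
Proof.
move=> [z zD <-]; exists (z 0 0), (z 0 1).
have fE u : root_poly (sigma z) u = (1 - z 0 0 * u) * (1 - z 0 1 * u).
  rewrite root_poly_sigma !big_ord_recl big_ord0 mulr1.
  by rewrite (_ : lift ord0 ord0 = 1) //; exact: val_inj.
have [|e0 e1] := @root_poly2_inj (sigma z) (z 0 0 + z 0 1) (z 0 0 * z 0 1).
  by move=> u; rewrite fE; ring.
by split; rewrite ?zD.
Qed.

(** These points form the royal variety s_1^2 = 4 s_2. *)
Definition royal x : 'rV[R[i]]_2 := sigma (const_mx x).

Lemma root_poly_royal x u : root_poly (royal x) u = (1 - x * u) ^+ 2.
Proof.
rewrite root_poly_sigma; under eq_bigr do rewrite mxE.
by rewrite prodr_const card_ord.
Qed.

Lemma royalE x : royal x 0 0 = 2 * x /\ royal x 0 1 = x ^+ 2.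
Proof. by apply: root_poly2_inj => u; rewrite root_poly_royal; ring. Qed.

Lemma royal_in x : `|x| < 1 -> G2 (royal x).
Proof. by move=> xD; exists (const_mx x) => // j; rewrite mxE. Qed.

(** On a line along which the first coordinate varies, the royal points are given
    by a quadratic equation in x, with roots m + d and m - d.  If both had modulus
    at least 1, then [apolar_disc_root] at their inverses would contradict the
    fact that s = sigma (z1, z2) is on the line.  If the first coordinate is
    constant, equal to z1 + z2, then x = (z1 + z2) / 2. *)
Lemma complex_line_meets_royal (L : set 'rV[R[i]]_2) s : complex_line L ->
  L s -> G2 s -> exists2 x, `|x| < 1 & L (royal x).
Proof.
move=> [a [v [v0 ->]]] [c _ <-] /symmetrized_bidisc_factor[z1 [z2 []]].
set s0 := a + _ => z1D z2D sE0 sE1 _.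
suff [x xD [l [l0 l1]]] : exists2 x, `|x| < 1 &
    exists l, s0 0 0 + l * v 0 0 = 2 * x /\ s0 0 1 + l * v 0 1 = x ^+ 2.
  exists x => //; exists (c + l) => //; have [r0 r1] := royalE x.
  rewrite scalerDl addrA; apply/rowP => k.
  have [->|->] := ord2 k.
    by rewrite r0 -l0 !mxE.
  by rewrite r1 -l1 !mxE.
have n2 : (2 : R[i]) != 0 by rewrite pnatr_eq0.
have [v00|v00] := eqVneq (v 0 0) 0.
  have v10 : v 0 1 != 0.
    apply: contraNneq v0 => v10; apply/eqP/rowP => k; rewrite mxE.
    by have [->|->] := ord2 k.
  exists (s0 0 0 / 2).
    rewrite normf_div sE0 normr_nat ltr_pdivrMr ?ltr0n //.
    by rewrite (le_lt_trans (ler_normD _ _)) // mul1r -[2]/(1 + 1) ltrD.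
  exists (((s0 0 0 / 2) ^+ 2 - s0 0 1) / v 0 1).
  by rewrite v00 mulr0 addr0 divfK //; split; field.
pose m := v 0 1 / v 0 0.
suff [x xD xE] : exists2 x, `|x| < 1 &
    x ^+ 2 - 2 * m * x + (m * s0 0 0 - s0 0 1) = 0.
  exists x => //; exists ((2 * x - s0 0 0) / v 0 0); split.
    by rewrite divfK // addrC subrK.
  apply/eqP; rewrite -subr_eq0 -oppr_eq0 -[X in _ == X]xE; apply/eqP.
  by rewrite /m; field.
pose d := sqrtC (m ^+ 2 - (m * s0 0 0 - s0 0 1)).
have dE : d ^+ 2 = m ^+ 2 - (m * s0 0 0 - s0 0 1) by rewrite sqrtCK.
have root_md e : e ^+ 2 = d ^+ 2 ->
    (m + e) ^+ 2 - 2 * m * (m + e) + (m * s0 0 0 - s0 0 1) = 0.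
  by rewrite dE => eE; rewrite sqrrD eE; ring.
have [x1D|x1D] := boolP (`|m + d| < 1).
  by exists (m + d) => //; exact: root_md.
have [x2D|x2D] := boolP (`|m - d| < 1).
  by exists (m - d) => //; apply: root_md; rewrite sqrrN.
have large x : ~~ (`|x| < 1) -> x != 0 /\ `|x^-1| <= 1.
  rewrite -real_leNgt ?normr_real ?real1 // => x1.
  have x0 : x != 0 by rewrite -normr_gt0 (lt_le_trans ltr01).
  by rewrite normfV invf_le1 ?normr_gt0.
have [x10 u1D] := large _ x1D; have [x20 u2D] := large _ x2D.
have := apolar_disc_root z1D z2D u1D u2D; case/eqP.
transitivity (2 * ((m + d) * (m - d) - m * (z1 + z2) + z1 * z2) /
    ((m + d) * (m - d))).
  by field; apply/andP.
rewrite (_ : _ - m * (z1 + z2) + z1 * z2 = 0) ?mulr0 ?mul0r //.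
by rewrite [_ * (m - d)]mulrC -subr_sqr dE sE0 sE1; ring.
Qed.

Lemma cvg_weighted_mean (T : Type) (F : set_system T) {FF : Filter F}
    (f g : T -> R[i]) (h : T -> 'rV[R[i]]_2) (a b : R[i]) (y q : 'rV[R[i]]_2) :
  f @ F --> a -> g @ F --> b -> h @ F --> y -> 1 - a + a * b != 0 ->
  (h z + (f z * g z / (1 - f z + f z * g z)) *: (q - h z)) @[z --> F] -->
    y + (a * b / (1 - a + a * b)) *: (q - y).
Proof.
move=> cf cg ch w0; have cfg := cvgM cf cg.
have cd : (1 - f z + f z * g z) @[z --> F] --> 1 - a + a * b.
  by apply: cvgD; [apply: cvgB; [exact: cvg_cst|exact: cf]|exact: cfg].
apply: cvgD; first exact: ch.
apply: cvgZ; last by apply: cvgB; [exact: cvg_cst|exact: ch].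
by apply: cvgM; [exact: cfg|exact: cvgV].
Qed.

Section Contraction.
Context (x : R[i]) (xD : `|x| < 1).

(** Conjugating the dilation s |-> (1 - t) s by an automorphism of the
    symmetrized bidisc that takes [royal x] to 0 yields the barycentre of s
    and [royal x] with weights 1 - t and t e.  The complex factor e
    compares the denominators of the automorphism at s and at [royal x]; it
    is what keeps the barycentre inside. *)
Definition royal_weight (t : R) s : R[i] :=
  let e := root_poly s x^* / (1 - `|x| ^+ 2) ^+ 2 in
  t%:C%C * e / (1 - t%:C%C + t%:C%C * e).

Definition royal_contraction (z : R * 'rV[R[i]]_2) : 'rV[R[i]]_2 :=
  z.2 + royal_weight z.1 z.2 *: (royal x - z.2).

Lemma royal_pencil_neq0 t s u : t \in `[0, 1] -> G2 s -> `|u| <= 1 ->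
  (1 - t%:C%C) * root_poly s u + t%:C%C *
    (root_poly s x^* / (1 - `|x| ^+ 2) ^+ 2) * root_poly (royal x) u != 0.
Proof.
rewrite in_itv /= => /andP[t0 t1].
move=> /symmetrized_bidisc_factor[z1 [z2 [z1D z2D _ _ sE]]] uD.
have := starlike_pencil_neq0 (t := 1 - t%:C%C) z1D z2D xD uD.
rewrite subr_ge0 lerBlDr lerDl lecR ler0c t0 t1 => /(_ isT).
by rewrite subKr !sE root_poly_royal.
Qed.

Lemma royal_weight_den_neq0 t s : t \in `[0, 1] -> G2 s ->
  1 - t%:C%C + t%:C%C * (root_poly s x^* / (1 - `|x| ^+ 2) ^+ 2) != 0.
Proof.
move=> t01 sG; have := royal_pencil_neq0 (u := 0) t01 sG.
rewrite normr0 ler01 root_poly_royal !root_poly2 expr0n !mulr0 subr0 addr0.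
by rewrite expr1n !mulr1; exact.
Qed.

Lemma royal_contraction_in t s : t \in `[0, 1] -> G2 s ->
  G2 (royal_contraction (t, s)).
Proof.
move=> t01 sG; apply/symmetrized_polydiscP => u uD.
rewrite root_poly_affine /royal_weight /=.
have w0 := royal_weight_den_neq0 t01 sG.
have := royal_pencil_neq0 t01 sG uD.
set e := root_poly s x^* / _ in w0 *; set w := 1 - _ + _ in w0 *.
apply: contra_neq => eq0.
transitivity (w * 0); last by rewrite mulr0.
by rewrite -eq0 /w; field.
Qed.

Lemma royal_contraction0 s : royal_contraction (0, s) = s.
Proof. by rewrite /royal_contraction /royal_weight /= !mul0r scale0r addr0. Qed.

Lemma royal_contraction1 s : G2 s -> royal_contraction (1, s) = royal x.
Proof.
move=> sG; have t1 : 1 \in `[0 : R, 1] by rewrite in_itv /= ler01 lexx.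
have := royal_weight_den_neq0 t1 sG.
rewrite /royal_contraction /royal_weight /= rmorph1 subrr add0r !mul1r => e0.
by rewrite divff // scale1r addrC subrK.
Qed.

Lemma royal_contraction_continuous t s : t \in `[0, 1] -> G2 s ->
  {for (t, s), continuous royal_contraction}.
Proof.
move=> t01 sG.
apply: cvg_weighted_mean; last exact: royal_weight_den_neq0.
- apply: (@cvg_comp _ _ _ fst (fun r : R => r%:C%C) _ (nbhs t)).
    exact: cvg_fst.
  exact: real_complex_continuous.
- apply: (@cvg_comp _ _ _ snd
    (fun r => root_poly r x^* / (1 - `|x| ^+ 2) ^+ 2) _ (nbhs s)).
    exact: cvg_snd.
  apply: cvgM; last exact: cvg_cst.
  exact: root_poly2_continuous.
- exact: cvg_snd.
Qed.

End Contraction.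

(** [royal_contraction] is an affine combination of its argument and of
    [royal x], so it stays on each line through [royal x]. *)
Lemma C_convex_symmetrized_bidisc : C_convex G2.
Proof.
move=> L lineL [s [sG Ls]].
have [x xD Lx] := complex_line_meets_royal lineL Ls sG.
have GLx : (G2 `&` L) (royal x) by split => //; exact: royal_in.
have GLc t y : t \in `[0, 1] -> (G2 `&` L) y ->
    (G2 `&` L) (royal_contraction x (t, y)).
  move=> t01 [yG Ly]; split; first exact: royal_contraction_in.
  rewrite /royal_contraction /=.
  move: lineL Lx Ly => [a [v [_ ->]]] [c1 _ <-] [c2 _ <-].
  set m := royal_weight _ _ _; exists (c2 + m * (c1 - c2)) => //.
  by rewrite opprD addrACA subrr add0r -scalerBl scalerA -addrA -scalerDl.
have [F0 F1 cF] : [/\ forall y, (G2 `&` L) y -> royal_contraction x (0, y) = y,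
    forall y, (G2 `&` L) y -> royal_contraction x (1, y) = royal x &
    forall t y, t \in `[0, 1] -> (G2 `&` L) y ->
      {for (t, y), continuous (royal_contraction x)}].
  split=> [y _|y []|t y t01 [yG _]]; first exact: royal_contraction0.
    by move=> yG _; exact: royal_contraction1.
  exact: royal_contraction_continuous.
by split; [exact: contractible_connected F0 F1 GLc cF|
  exact: contractible_simply_connected F0 F1 GLc cF].
Qed.

End SymmetrizedBidisc.

(** * A disconnected complex section in dimension at least 3 *)

Lemma cubic_rotate (C : numFieldType) (j a b : C) : j ^+ 2 = -1 ->
  1 - 2 * (j * a) * (j * b) + 4 / 3 * (j * b) ^+ 2
    - 8 / 27 * (j * a) * (j * b) ^+ 3 =
  1 + 2 * a * b - 4 / 3 * b ^+ 2 - 8 / 27 * a * b ^+ 3.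
Proof.
move=> j2; transitivity (1 - 2 * (j ^+ 2) * a * b + 4 / 3 * (j ^+ 2) * b ^+ 2
  - 8 / 27 * (j ^+ 2) ^+ 2 * a * b ^+ 3); first by field.
by rewrite j2; field.
Qed.

Lemma real_complex_cubic (R : realType) (k c d a b : R) :
  (1 + k * a * b - c * b ^+ 2 - d * a * b ^+ 3)%:C%C = 1 + k%:C%C * a%:C%C * b%:C%C
    - c%:C%C * b%:C%C ^+ 2 - d%:C%C * a%:C%C * b%:C%C ^+ 3 :> R[i].
Proof. by rewrite !rmorphB rmorphD !rmorphM. Qed.

Section NotCConvex.
Context (R : realType) (n : nat).
Implicit Types (l u : R[i]).

(** The parameters 1 and -1 on this line give sigma (t, t, t, 0, ..., 0) and
    sigma (-t, -t, -t, 0, ..., 0) for t = 2/3; any t with 0 < t < 1 < 3 t^2 would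
    do. *)
Definition cubic_base : 'rV[R[i]]_n.+3 := \row_k [:: 0; 4 / 3]`_k.
Definition cubic_dir : 'rV[R[i]]_n.+3 := \row_k [:: 2; 0; 8 / 27]`_k.

Lemma root_poly_cubic l u : root_poly (cubic_base + l *: cubic_dir) u =
  1 - 2 * l * u + 4 / 3 * u ^+ 2 - 8 / 27 * l * u ^+ 3.
Proof.
rewrite /root_poly !big_ord_recl big1 => [|k _]; last first.
  by rewrite !mxE /= nth_nil mulr0 addr0 mulr0.
by rewrite !mxE /=; field.
Qed.

Lemma cubic_in (e : R) : e ^+ 2 = 1 ->
  symmetrized_polydisc R n.+3 (cubic_base + e%:C%C *: cubic_dir).
Proof.
move=> e2; apply/symmetrized_polydiscP => u uD.
have e2C : e%:C%C ^+ 2 = 1 :> R[i] by rewrite -rmorphXn e2.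
have -> : root_poly (cubic_base + e%:C%C *: cubic_dir) u =
    (1 - (2 / 3 * e%:C%C) * u) ^+ 3.
  rewrite root_poly_cubic.
  transitivity (1 - 2 * e%:C%C * u + 4 / 3 * (e%:C%C ^+ 2) * u ^+ 2
    - 8 / 27 * e%:C%C * (e%:C%C ^+ 2) * u ^+ 3); first by rewrite e2C; field.
  by field.
rewrite expf_neq0 // onem_mul_neq0 // normrM.
have -> : `|e%:C%C| = 1 :> R[i].
  by apply/eqP; rewrite -sqrp_eq1 // -normrX e2C normr1.
by rewrite mulr1 normf_div !normr_nat ltr_pdivrMr ?ltr0n // mul1r ltr_nat.
Qed.

(** Substituting u = i y turns root_poly into a cubic p in y with real
    coefficients, p 0 = 1 and p 1 + p (-1) = - 2/3.  So p vanishes somewhere in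
    [-1, 1]; by the symmetry (t, y) -> (- t, - y) only t <= 0 matters, where
    p 1 < 0. *)
Lemma cubic_notin (t : R) :
  ~ symmetrized_polydisc R n.+3 (cubic_base + (0 +i* t)%C *: cubic_dir).
Proof.
pose p (t : R) : {poly R} :=
  1 + (2 * t) *: 'X - (4 / 3) *: 'X^2 - (8 / 27 * t) *: 'X^3.
have pE r y : (p r).[y] = 1 + 2 * r * y - 4 / 3 * y ^+ 2 - 8 / 27 * r * y ^+ 3.
  by rewrite /p !hornerE.
have root_p r : r <= 0 -> exists2 y, 0 <= y <= 1 & (p r).[y] = 0.
  move=> r0; have [|y y01 /rootP py] := @poly_ivt R (- p r) 0 1 ler01.
    by rewrite !hornerN !pE; lra.
  by exists y => //; move: py; rewrite hornerN => /eqP; rewrite oppr_eq0 => /eqP.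
have [y y1 py] : exists2 y : R, `|y| <= 1 & (p t).[y] = 0.
  have [t0|t0] := leP t 0.
    by have [y y01 py] := root_p t t0; exists y => //; rewrite ler_norml; lra.
  have [|y y01 py] := root_p (- t); first by lra.
  exists (- y); first by rewrite normrN ler_norml; lra.
  by move: py; rewrite !pE => <-; ring.
have uD : `|(0 +i* y)%C| <= 1 :> R[i].
  by rewrite normc_def /= expr0n add0r sqrtr_sqr lecR.
move=> /symmetrized_polydiscP /(_ _ uD)/eqP; apply; rewrite root_poly_cubic.
have iE r : (0 +i* r)%C = 'i%C * r%:C%C :> R[i] by simpc.
rewrite (iE t) (iE y) cubic_rotate; last exact: sqr_i.
have E2 : 2%:C%C = 2 :> R[i] by rewrite rmorph_nat.
have E4 : (4 / 3)%:C%C = 4 / 3 :> R[i] by rewrite fmorph_div /= !rmorph_nat.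
have E8 : (8 / 27)%:C%C = 8 / 27 :> R[i] by rewrite fmorph_div /= !rmorph_nat.
by rewrite -E2 -E4 -E8 -real_complex_cubic -pE py.
Qed.

(** The first coordinate 2 l of the point of parameter l has real part 2 and -2
    at l = 1 and l = -1, but never 0 on the section, where l would be
    purely imaginary. *)
Lemma not_C_convex_symmetrized_polydisc :
  ~ C_convex (symmetrized_polydisc R n.+3).
Proof.
pose L := [set cubic_base + l *: cubic_dir | l in [set: R[i]]].
have lineL : complex_line L.
  exists cubic_base, cubic_dir; split => //.
  apply/eqP => /rowP/(_ 0); rewrite !mxE /= => /eqP.
  by rewrite pnatr_eq0.
have G1 (e : R) : e ^+ 2 = 1 ->
    (symmetrized_polydisc R n.+3 `&` L) (cubic_base + e%:C%C *: cubic_dir).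
  by move=> e2; split; [exact: cubic_in|exists e%:C%C].
move=> /(_ _ lineL) [|cGL _].
  by exists (cubic_base + 1%:C%C *: cubic_dir); apply: G1; rewrite expr1n.
pose f (s : 'rV[R[i]]_n.+3) : R := complex.Re (s 0 0).
have fE l : f (cubic_base + l *: cubic_dir) = complex.Re l * 2.
  rewrite /f !mxE /= add0r; case: l => a b /=; lra.
have cf : continuous f.
  move=> s.
  exact: (cvg_comp _ _ (@coord_continuous _ _ _ _ _ s) (@Re_continuous R _)).
have /connected_intervalP If :=
  connected_continuous_connected cGL (continuous_subspaceT cf).
have If2 (e : R) : e ^+ 2 = 1 ->
    [set f s | s in symmetrized_polydisc R n.+3 `&` L] (e * 2).
  move=> e2; exists (cubic_base + e%:C%C *: cubic_dir); first exact: G1.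
  exact: fE.
have [|||s [sG [l _ ls]]] := If (-1 * 2) (1 * 2) _ _ 0.
- by apply: If2; rewrite sqrrN expr1n.
- by apply: If2; rewrite expr1n.
- by apply/andP; lra.
rewrite -ls fE => /eqP; rewrite mulf_eq0 pnatr_eq0 orbF => /eqP l0.
apply: (@cubic_notin (complex.Im l)); move: sG; rewrite -ls.
by case: l l0 {ls} => a b /= ->.
Qed.

End NotCConvex.

Theorem theorem5p6 (R : realType) :
  (domain (symmetrized_polydisc R 2) /\ C_convex (symmetrized_polydisc R 2)) /\
  (forall n : nat, (3 <= n)%N ->
    [/\ domain (symmetrized_polydisc R n),
        linearly_convex (symmetrized_polydisc R n) &
        ~ C_convex (symmetrized_polydisc R n)]).
Proof.
split; first by split; [exact: domain_symmetrized_polydisc|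
                        exact: C_convex_symmetrized_bidisc].
move=> n; case: n => [|[|[|n]]] // _; split.
- exact: domain_symmetrized_polydisc.
- exact: linearly_convex_symmetrized_polydisc.
- exact: not_C_convex_symmetrized_polydisc.
Qed.
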